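(* Let $\mathcal N$ be a commutative nilpotent algebra over $\mathbb F$ and let $\pi=\pi^2\in\mathrm{End}(\mathcal N)$ be a projection on $\mathcal N$. Assume that $\mathcal N=\bigoplus_{k\in\mathbb Z^+}\mathcal N_k$ is a $\pi$-grading and that there exists an integer $d>0$ with $\pi(\mathcal N)\subset\mathcal N_d$ and $\pi(\mathcal N_k)=0$ for all $k\ne d$. Let $\mathbf f:=\pi\circ\exp_1:\mathcal N\to\mathcal N$. Then the affine subgroup $\mathsf A_{\mathbf f}\subset\mathrm{Aff}(\mathcal N)$ acts transitively on $S=\mathbf f^{-1}(0)$. In case $\pi(\mathcal N)\subset\mathrm{Ann}(\mathcal N)$ the group $\mathsf A_{\mathbf f}$ even acts transitively on every level set $\mathbf f^{-1}(c)=S+c$ with $c\in\pi(\mathcal N)$.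
   Context: $\mathbb F$ is a field of characteristic $0$; algebras are associative $\mathbb F$-algebras, possibly of infinite dimension. An algebra $\mathcal N$ is nilpotent if $\mathcal N^{k+1}=0$ for some $k$, where $\mathcal N^1=\mathcal N$ and $\mathcal N^{k+1}$ is the linear span of $\mathcal N\mathcal N^k$. $\mathrm{Ann}(\mathcal N)=\{x\in\mathcal N:x\mathcal N=0\}$ for commutative $\mathcal N$. Put $\exp_1(x)=\sum_{k\ge1}x^k/k!$ for $x\in\mathcal N$ (a finite sum). A vector space decomposition $\mathcal N=\bigoplus_{k\in\mathbb Z^+}\mathcal N_k$ ($\mathbb Z^+$ the positive integers) is called a $\pi$-grading if $\mathcal N_j\mathcal N\subset\bigoplus_{\ell>j}\mathcal N_\ell$ for all $j>0$, and $\pi(\mathcal N_{j_1}\mathcal N_{j_2}\cdots\mathcal N_{j_r})\subset\pi(\mathcal N_{j_1+j_2+\dots+j_r})$ for every finite sequence $j_1,\dots,j_r$ in $\mathbb Z^+$. $\mathrm{Aff}(\mathcal N)$ is the group of all affine bijections of $\mathcal N$, and $\mathsf A_{\mathbf f}:=\{g\in\mathrm{Aff}(\mathcal N):\mathbf f\circ g^{-1}=\mathbf f\}$. *)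

(* Defs.v *)
From mathcomp Require Import all_boot all_algebra.
From mathcomp Require Import all_classical.
From mathcomp Require Export sesquilinear.

(* MathComp rings and algebras are unital, whereas nilpotent algebras are not;
   an algebra is therefore given by a left module N over a field together with
   a product mul : {bilinear N -> N -> N}, with associativity and commutativity
   as separate hypotheses. *)

Set Implicit Arguments.
Unset Strict Implicit.
Unset Printing Implicit Defensive.

Import GRing.Theory.

Local Open Scope classical_set_scope.
Local Open Scope ring_scope.

Section NilpotentAlgebra.
Variables (F : fieldType) (N : lmodType F).

Definition lin_span (A : set N) : set N :=
  [set x | exists (n : nat) (a : 'I_n -> F) (v : 'I_n -> N),
     (forall i, A (v i)) /\ x = \sum_(i < n) a i *: v i].

Definition is_subspace (A : set N) : Prop :=
  A 0 /\ forall (a : F) (x y : N), A x -> A y -> A (a *: x + y).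

Variable mul : N -> N -> N.

(* The set of products, not its span. *)
Definition mulset (A B : set N) : set N := [set mul x y | x in A & y in B].

(* alg_pow k is N^k for k >= 1; alg_pow 0 is a junk value. *)
Definition alg_pow (k : nat) : set N :=
  iter k.-1 (fun A => lin_span (mulset [set: N] A)) [set: N].

Definition nilpotent_alg : Prop :=
  exists k : nat, alg_pow k.+1 `<=` [set 0].

Definition annihilator : set N := [set x | forall y, mul x y = 0].

(* elt_pow x k is x^k for k >= 1; elt_pow x 0 is a junk value. *)
Definition elt_pow (x : N) (k : nat) : N := iter k.-1 (mul x) x.

(* A finitely supported sum whenever mul is nilpotent (and 0 by convention
   when infinitely many terms are nonzero). *)
Definition exp1 (x : N) : N :=
  \sum_(k \in [set k : nat | (0 < k)%N]) ((k`!)%:R : F)^-1 *: elt_pow x k.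

(* In what follows G k stands for the component of degree k > 0, and G 0 is
   ignored. *)

Definition component_family (G : nat -> set N) (I : set nat)
    (u : nat -> N) : Prop :=
  (forall k, I k -> G k (u k)) /\ finite_set [set k | I k /\ u k != 0].

Definition sum_components (G : nat -> set N) (I : set nat) : set N :=
  [set x | exists2 u, component_family G I u & x = \sum_(k \in I) u k].

Definition direct_decomposition (G : nat -> set N) : Prop :=
  let pos := [set k : nat | (0 < k)%N] in
  [/\ forall k, (0 < k)%N -> is_subspace (G k),
      sum_components G pos = [set: N]
    & forall u, component_family G pos u -> \sum_(k \in pos) u k = 0 ->
        forall k, (0 < k)%N -> u k = 0].

(* The sequence j_1, ..., j_r (r >= 1) is j :: js. *)
Definition pi_grading (pi : N -> N) (G : nat -> set N) : Prop :=
  [/\ direct_decomposition G,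
      forall j, (0 < j)%N ->
        mulset (G j) [set: N] `<=` sum_components G [set l | (j < l)%N]
    & forall (j : nat) (js : seq nat), all (fun i => (0 < i)%N) (j :: js) ->
        pi @` foldl (fun A i => mulset A (G i)) (G j) js
          `<=` pi @` G (sumn (j :: js))].

End NilpotentAlgebra.

Section AffineGroup.
Variables (F : fieldType) (N : lmodType F).

Definition affine_map (g : N -> N) : Prop :=
  exists (L : {linear N -> N}) (b : N), forall x, g x = L x + b.

Definition Aff : set (N -> N) := [set g | affine_map g /\ bijective g].

(* The function h is g^-1. *)
Definition aff_stab (T : Type) (f : N -> T) : set (N -> N) :=
  [set g | Aff g /\ exists h, [/\ cancel g h, cancel h g & f \o h = f]].

End AffineGroup.

(* Only used for a group A of bijections of T: S is A-stable and is a single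
   orbit, in particular nonempty. *)
Definition acts_transitively (T : Type) (A : set (T -> T)) (S : set T) : Prop :=
  [/\ S !=set0,
      forall g x, A g -> S x -> S (g x)
    & forall x y, S x -> S y -> exists2 g, A g & g x = y].

(* Main.v *)
Require Import Defs.
From mathcomp Require Import all_boot all_algebra.
From mathcomp Require Import all_classical.
From mathcomp Require Import ring.
From HB Require Import structures.

(* Write exp x = sum_m E_m with E_m of weight m in the components x_k of x.
   For psi in N_j with 0 < j < d the affine map
     g x = sum_(k <= d) x_k exp(k psi) + sum_(k > d) x_k + b,
     where exp b = exp(- d psi) (1 + j psi),
   preserves f: one has exp (g x) = sum_m E_m exp((m - d) psi) (1 + j psi) up
   to terms killed by pi, and if m + i j = d with i > 0, then the coefficient
   of psi^i in exp(- i j psi) (1 + j psi) is 0.  As psi varies, g changes the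
   lowest nonzero component of a point of S, of degree j < d, by an arbitrary
   amount while leaving the smaller ones zero, so that finitely many such maps
   move the point into the sum of the N_k, k >= d.  There f is affine under
   translations, f (y + z) = f y + pi z, and a last translation leads to 0. *)

Set Implicit Arguments.
Unset Strict Implicit.
Unset Printing Implicit Defensive.

Import GRing.Theory.

Local Open Scope classical_set_scope.
Local Open Scope ring_scope.

(** * Truncated exponential and logarithm of nilpotent elements *)

Section TruncatedExponential.
Variables (F : fieldType) (charF0 : [pchar F] =i pred0) (R : comAlgType F).
Variable K : nat.

Definition texp (a : R) : R := \sum_(k < K) (k`!%:R : F)^-1 *: a ^+ k.

Lemma fact_neq0 n : (n`!%:R : F) != 0.
Proof. by rewrite ((pcharf0P F).1 charF0) -lt0n fact_gt0. Qed.

Lemma exprD_fact (a b : R) n :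
  (n`!%:R : F)^-1 *: (a + b) ^+ n =
  \sum_(i < n.+1) ((i`!%:R : F)^-1 *: a ^+ i) * (((n - i)`!%:R)^-1 *: b ^+ (n - i)).
Proof.
rewrite addrC exprDn scaler_sumr; apply: eq_bigr => i _.
rewrite -scalerAl -scalerAr scalerA -scaler_nat scalerA mulrC; congr (_ *: _);
  last exact: mulrC.
have /(congr1 (fun m => m%:R : F)) := bin_fact (ltn_ord i : (i <= n)%N).
rewrite !natrM => <-; rewrite !invfM mulVKf //.
by rewrite ((pcharf0P F).1 charF0) -lt0n bin_gt0 -ltnS.
Qed.

(** The left side sums the terms [G i l] over the triangle [i + l < K], the right side over the
    square [i, l < K]; the hypothesis kills the difference. *)
Lemma texpD (a b : R) :
  (forall i j : nat, (K <= i + j)%N -> a ^+ i * b ^+ j = 0) ->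
  texp (a + b) = texp a * texp b.
Proof.
move=> ab0; rewrite /texp.
under eq_bigr do rewrite exprD_fact.
rewrite big_distrl /=.
pose G i l := ((i`!%:R : F)^-1 *: a ^+ i) * ((l`!%:R : F)^-1 *: b ^+ l).
have G0 i l : (K <= i + l)%N -> G i l = 0.
  by move=> il; rewrite /G -scalerAl -scalerAr ab0 // !scaler0.
transitivity (\sum_(n < K) \sum_(i < K | (i <= n)%N) G i (n - i)%N).
  apply: eq_bigr => n _; rewrite -(big_mkord (fun i => true) (fun i => G i (n - i)%N)).
  rewrite -(big_mkord (fun i => i <= n)%N (fun i => G i (n - i)%N)).
  rewrite [in RHS](big_cat_nat (n := n.+1)) //=.
  rewrite [X in _ + X]big1_seq ?addr0; last first.
    by move=> i; rewrite mem_index_iota; case/andP=> h /andP[]; rewrite ltnNge h.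
  rewrite [RHS]big_nat_cond [LHS]big_nat_cond; apply: eq_bigl => i /=.
  by rewrite ltnS; case: (i <= n)%N; rewrite ?andbF.
rewrite (exchange_big_dep predT) //=; apply: eq_bigr => i _.
rewrite big_distrr /= -/(G _ _).
rewrite -(big_mkord (fun n => i <= n)%N (fun n => G i (n - i)%N)).
rewrite -(big_mkord predT (fun l => G i l)).
rewrite (big_cat_nat (n := i)) //=; last exact: ltnW.
rewrite [X in X + _]big1_seq ?add0r; last first.
  by move=> n; rewrite mem_index_iota; case/andP=> h /andP[_]; rewrite ltnNge h.
rewrite -{1}[nat_of_ord i]add0n big_addn.
rewrite [RHS](big_cat_nat (n := K - i)) //=; last exact: leq_subr.
rewrite [X in _ + X]big1_seq ?addr0; last first.
  by move=> l /=; rewrite mem_index_iota leq_subLR => /andP[h _]; exact: G0.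
rewrite [LHS]big_mkcond [RHS]big_nat big_nat; apply: eq_bigr => l _.
by rewrite leq_addl addnK.
Qed.

(** A common nilpotent factor is enough: [(a * b) ^+ i * (a * c) ^+ l] is a multiple of
    [a ^+ (i + l)]. *)
Lemma texpD_dvd (a b c : R) : a ^+ K = 0 ->
  texp (a * b + a * c) = texp (a * b) * texp (a * c).
Proof.
move=> aK; apply: texpD => i l il.
by rewrite !exprMn mulrACA -exprD -(subnK il) exprD aK mulr0 mul0r.
Qed.

Lemma texpMn (a : R) m : a ^+ K = 0 -> texp (a *+ m) = texp a ^+ m.
Proof.
move=> aK; elim: m => [|m IHm].
  have K0 : (0 < K)%N.
    by rewrite lt0n; apply: contra_eq_neq aK => ->; rewrite expr0 oner_eq0.
  rewrite expr0 mulr0n /texp -(prednK K0) big_ord_recl expr0 fact0 invr1 scale1r.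
  by rewrite big1 ?addr0 // => i _; rewrite expr0n scaler0.
have -> : a *+ m.+1 = a * 1 + a * m%:R by rewrite mulr1 mulr_natr mulrS.
by rewrite texpD_dvd // mulr1 mulr_natr IHm exprS.
Qed.

(** The sum keeps its vanishing term of degree [K], so that its index range is again ['I_K]. *)
Lemma texp_expand (a : R) : a ^+ K = 0 ->
  texp a = 1 + \sum_(i < K) (i.+1`!%:R : F)^-1 *: a ^+ i.+1.
Proof.
move=> aK.
rewrite /texp; case: K aK => [|k] aK.
  by move/eqP: aK; rewrite expr0 oner_eq0.
by rewrite big_ord_recl big_ord_recr /= aK scaler0 addr0 expr0 fact0 invr1 scale1r.
Qed.

Lemma texp_order2 (a : R) : a ^+ K = 0 -> exists e, texp a = 1 + a + a ^+ 2 * e.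
Proof.
move=> aK; rewrite texp_expand //; case: K aK => [|k aK].
  by rewrite expr0 => /eqP; rewrite oner_eq0.
exists (\sum_(i < k) (i.+2`!%:R : F)^-1 *: a ^+ i).
rewrite big_ord_recl /= factS fact0 muln1 invr1 scale1r expr1 addrA; congr (_ + _).
rewrite mulr_sumr; apply: eq_bigr => i _.
by rewrite -scalerAr -exprD.
Qed.

(* By induction on the nilpotency order of y: (1 + y) exp(- y) is 1 plus a
   multiple of y^2. *)
Lemma texp_log (y : R) : y ^+ K = 0 -> exists c, texp (y + y ^+ 2 * c) = 1 + y.
Proof.
move=> yK.
(* An exponent that is a power of two suits the passage from [y] to [y ^+ 2 * h], which halves
   it. *)
have yn : y ^+ (2 ^ K) = 0.
  by rewrite -(subnK (ltnW (ltn_expl K (ltnSn 1)))) exprD yK mulr0.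
elim: {-2}K y yn yK => [|n IHn] y yn yK.
  have y0 : y = 0 by rewrite -[y]expr1.
  exists 0; rewrite mulr0 !addr0.
  by have := texpMn 0 yK; rewrite mulr0n expr0 y0 addr0.
have [|e ee] := @texp_order2 (- y); first by rewrite exprNn yK mulr0.
pose h := -1 + e + y * e.
have hE : (1 + y) * texp (- y) = 1 + y ^+ 2 * h by rewrite ee /h; ring.
have [||c cE] := IHn (y ^+ 2 * h).
- by rewrite exprMn -exprM -expnS yn mul0r.
- rewrite exprMn exprAC yK expr0n; case: K yK => [/eqP|k _] /=.
    by rewrite oner_eq0.
  by rewrite mul0r.
(* In terms of logarithms, [log (1 + y) = y + log (1 + y ^+ 2 * h)], where the last logarithm is
   [y ^+ 2 * h + (y ^+ 2 * h) ^+ 2 * c] by induction. Both summands are multiples of [y], as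
   [texpD_dvd] requires. *)
exists (h + y ^+ 2 * h ^+ 2 * c).
have -> : y + y ^+ 2 * (h + y ^+ 2 * h ^+ 2 * c)
    = y * 1 + y * (y * h + (y * h * y) ^+ 2 * y * 0 + y * y * y * h ^+ 2 * c) by ring.
rewrite texpD_dvd //.
have -> : y * (y * h + (y * h * y) ^+ 2 * y * 0 + y * y * y * h ^+ 2 * c)
  = y ^+ 2 * h + (y ^+ 2 * h) ^+ 2 * c by ring.
have texpN : texp y * texp (- y) = 1.
  rewrite -mulrN1 -{1}[y]mulr1 -texpD_dvd // mulrN subrr.
  by have := @texpMn y 0 yK; rewrite mulr0n expr0.
by rewrite cE -hE mulr1 mulrCA texpN mulr1.
Qed.

End TruncatedExponential.

(** * Invariance of a linear map under reparametrization by [exp psi] *)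

Section Reparametrization.
Variables (F : fieldType) (charF0 : [pchar F] =i pred0) (R : comAlgType F).
Variable K : nat.

(** The left side is [(1 + j psi) exp(c psi)]. The coefficients are factored so as to show that the
    one of [psi ^+ i.+1] vanishes when [m + i.+1 * j = d]. *)
Lemma texp_reparam_coef (psi : R) (j m d : nat) : psi ^+ K = 0 ->
  let c : F := m%:R - d%:R in
  texp K (- (psi *+ d)) * (1 + psi *+ j) * texp K psi ^+ m =
  1 + \sum_(i < K) (c ^+ i / (i.+1)`!%:R * (c + (i.+1 * j)%:R)) *: psi ^+ i.+1.
Proof.
move=> psiK c.
have -> : texp K (- (psi *+ d)) * (1 + psi *+ j) * texp K psi ^+ m =
          (1 + psi *+ j) * texp K (c *: psi).
  rewrite -texpMn // mulrAC mulrC; congr (_ * _).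
  have -> : c *: psi = psi * - d%:R + psi * m%:R.
    by rewrite scalerBl !scaler_nat mulrN !mulr_natr addrC.
  by rewrite texpD_dvd // mulrN !mulr_natr.
rewrite mulrDl mul1r {1}texp_expand //; last by rewrite exprZn psiK scaler0.
rewrite -addrA; congr (_ + _); rewrite /texp mulr_sumr -big_split /=.
apply: eq_bigr => i _; rewrite !exprZn !scalerA mulrnAl -scaler_nat -scalerAr scalerA.
rewrite -exprS -scalerDl; congr (_ *: _).
have fS : (i.+1`!%:R : F) = i.+1%:R * i`!%:R by rewrite factS natrM.
have f0 : (i`!%:R : F) != 0 by exact: fact_neq0.
have S0 : (i.+1%:R : F) != 0 by rewrite ((pcharf0P F).1 charF0).
rewrite fS natrM exprS.
set s := i.+1%:R in S0 *; set t := i`!%:R in f0 *; set e := c ^+ i.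
by field; rewrite f0 addrC natr1.
Qed.

Lemma texp_reparam (V : lmodType F) (lam : {linear R -> V}) (Q : {poly R})
    (psi b : R) (j d : nat) :
  psi ^+ K = 0 -> texp K b = texp K (- (psi *+ d)) * (1 + psi *+ j) ->
  (forall m i, (m + i.+1 * j)%N <> d -> lam (Q`_m * psi ^+ i.+1) = 0) ->
  lam (texp K b * Q.[texp K psi]) = lam Q.[1].
Proof.
move=> psiK bE lam0; rewrite bE !horner_coef mulr_sumr !linear_sum.
apply: eq_bigr => m _; rewrite expr1n mulr1 mulrCA texp_reparam_coef //.
rewrite mulrDr mulr1 linearD mulr_sumr linear_sum big1 ?addr0 //= => i _.
rewrite -scalerAr linearZ /=.
have [mid|mid] := eqVneq (m + i.+1 * j)%N d; last first.
  by rewrite lam0 ?scaler0 //; apply/eqP.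
by rewrite -mid natrD opprD addrA subrr add0r addNr mulr0 scale0r.
Qed.

(** The sum is the truncated exponential of [X], with the scalars of [F] sent into [R] because
    polynomials are scaled by [R]. *)
Lemma horner_texp (X : {poly R}) u :
  (\sum_(k < K) ((k`!%:R : F)^-1)%:A *: X ^+ k).[u] = texp K X.[u].
Proof.
rewrite horner_sum; apply: eq_bigr => k _.
by rewrite hornerZ horner_exp -scalerAl mul1r.
Qed.

Variable W : nat -> R -> Prop.
Hypotheses (W0 : forall m, W m 0) (W1 : W 0%N 1)
  (WD : forall m a b, W m a -> W m b -> W m (a + b))
  (WZ : forall m (c : F) a, W m a -> W m (c *: a))
  (WM : forall m n a b, W m a -> W n b -> W (m + n)%N (a * b)).

Lemma weight_sum m (I : Type) (r : seq I) (P : pred I) (f : I -> R) :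
  (forall i, P i -> W m (f i)) -> W m (\sum_(i <- r | P i) f i).
Proof. by move=> Wf; elim/big_ind: _ => //; exact: WD. Qed.

(** Coefficient [m] of a power of [X] is a sum of products of coefficients whose degrees add up to
    [m]. *)
Lemma weight_texp (X : {poly R}) : (forall m, W m X`_m) ->
  forall m, W m (\sum_(k < K) ((k`!%:R : F)^-1)%:A *: X ^+ k)`_m.
Proof.
move=> WX m; rewrite coef_sum; apply: weight_sum => k _.
rewrite coefZ -scalerAl mul1r; apply: WZ.
elim: {k}(k : nat) m => [|k IHk] m.
  by rewrite expr0 coef1; case: m.
rewrite exprS coefM; apply: weight_sum => i _.
by rewrite -{1}(subnKC (ltn_ord i : (i <= m)%N)); exact: WM.
Qed.

End Reparametrization.

(** * Adjoining a unit to a commutative algebra *)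

Section Unitization.
Variables (F : fieldType) (N : lmodType F) (mul : {bilinear N -> N -> N}).
Variables (mulA : associative mul) (mulC : commutative mul).

(** The two proofs are arguments of the type so that its ring structure can be inferred from the
    type alone. *)
Definition unitization of associative mul & commutative mul : Type := (F^o * N)%type.
Local Notation A := (unitization mulA mulC).

HB.instance Definition _ := GRing.Lmodule.copy A (F^o * N)%type.

Definition unitization_one : A := (1, 0).
Definition unitization_mul (a b : A) : A :=
  (a.1 * b.1, a.1 *: b.2 + b.1 *: a.2 + mul a.2 b.2).

Fact unitization_mulA : associative unitization_mul.
Proof.
move=> [a x] [b y] [c z]; congr pair; rewrite /= ?mulrA //.
rewrite !linearDr !linearDl !linearZr_LR !linearZl_LR /= !scalerDr !scalerA mulA.
rewrite [c * a]mulrC [c * b]mulrC.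
by rewrite [LHS](AC (4 * 3) ((1 * (2 * 4 * 6)) * (3 * 5 * 7))).
Qed.

Fact unitization_mulC : commutative unitization_mul.
Proof.
by move=> [a x] [b y]; congr pair; rewrite /= 1?mulrC // mulC [a *: y + _]addrC.
Qed.

Fact unitization_mul1 : left_id unitization_one unitization_mul.
Proof.
by move=> [a x]; congr pair; rewrite /= ?mul1r // scale1r scaler0 linear0l !addr0.
Qed.

Fact unitization_mulD : left_distributive unitization_mul +%R.
Proof.
move=> [a x] [b y] [c z]; congr pair; rewrite /= ?mulrDl //.
rewrite linearDl scalerDl scalerDr.
by rewrite [LHS](AC (2 * 2 * 2) ((1 * 3 * 5) * (2 * 4 * 6))).
Qed.

Fact unitization_one_neq0 : unitization_one != 0.
Proof. by apply/eqP => -[/eqP]; rewrite oner_eq0. Qed.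

HB.instance Definition _ := GRing.Zmodule_isComNzRing.Build A
  unitization_mulA unitization_mulC unitization_mul1 unitization_mulD
  unitization_one_neq0.

Fact unitization_scaleAl (k : F) (a b : A) : k *: (a * b) = (k *: a) * b.
Proof.
case: a b => [a x] [b y]; congr pair; rewrite /= -?scalerAl //.
by rewrite !scalerDr !scalerA linearZl_LR /= [k * b]mulrC.
Qed.

HB.instance Definition _ := GRing.Lmodule_isLalgebra.Build F A unitization_scaleAl.
HB.instance Definition _ := GRing.Lalgebra_isComAlgebra.Build F A.

End Unitization.

(** * Unipotent maps, affine maps and stabilizers *)

Section LinearMaps.
Variables (F : fieldType) (N : lmodType F).

Lemma linear_bundle (h : N -> N) : linear h -> exists L : {linear N -> N}, h =1 L.
Proof.
move=> hlin; pose L : {linear N -> N} := HB.pack h (GRing.isLinear.Build _ _ _ _ h hlin).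
by exists L.
Qed.

(** The inverse is the finite Neumann series with terms [t i x], the [i]-th power of [- D] at [x];
    both composites telescope. *)
Lemma unipotent_bijective (D : {linear N -> N}) n :
  (forall x, iter n D x = 0) -> bijective (fun x => x + D x).
Proof.
move=> Dn; pose t i x := (-1) ^+ i *: iter i D x.
have Dt i x : D (t i x) = - t i.+1 x.
  by rewrite /t linearZ /= exprS mulN1r scaleNr opprK.
have tD i x : t i (x + D x) = t i x - t i.+1 x.
  rewrite -Dt /t linearZ /= -iterS iterSr -scalerDr; congr (_ *: _).
  by elim: i => //= i ->; rewrite linearD.
have tsum x : \sum_(i < n) (t i x - t i.+1 x) = x.
  rewrite -(big_mkord predT (fun i => t i x - t i.+1 x)).
  have /(congr1 -%R) := telescope_sumr (t^~ x) (leq0n n).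
  rewrite -sumrN opprB {3 4}/t expr0 scale1r Dn scaler0 subr0 => /= tel.
  rewrite -[RHS]tel.
  by apply: eq_bigr => i _; rewrite opprB.
exists (fun x => \sum_(i < n) t i x) => x.
  by under eq_bigr do rewrite tD; exact: tsum.
by rewrite linear_sum -big_split /=; under eq_bigr do rewrite Dt; exact: tsum.
Qed.

Lemma affine_mapP (g : N -> N) : affine_map g <-> linear (fun x => g x - g 0).
Proof.
split=> [[L [b gE]] a x y|/linear_bundle[L LE]].
  by rewrite !gE linear0 add0r !addrK linearP.
by exists L, (g 0) => x; rewrite -LE subrK.
Qed.

(** Commuting with these affine combinations involves no linear part, so it passes directly to
    inverses and composites. *)
Lemma affine_mapE (g : N -> N) : affine_map g ->
  forall a x y z, g (a *: (x - y) + z) = a *: (g x - g y) + g z.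
Proof.
move=> [L [b gE]] a x y z; rewrite !gE linearP linearB addrA; congr (_ + _ + _).
by rewrite opprD addrACA subrr addr0.
Qed.

Lemma affine_inv (g h : N -> N) :
  affine_map g -> cancel g h -> cancel h g -> affine_map h.
Proof.
move=> /affine_mapE gE gK hK; apply/affine_mapP => a x y.
have hE a' x' y' z' : h (a' *: (x' - y') + z') = a' *: (h x' - h y') + h z'.
  by apply: (can_inj gK); rewrite gE !hK.
by rewrite -[X in h (_ *: X + _)]subr0 hE addrA.
Qed.

Lemma affine_comp (g h : N -> N) : affine_map g -> affine_map h -> affine_map (g \o h).
Proof.
move=> /affine_mapE gE /affine_mapE hE; apply/affine_mapP => a x y.
have ghE a' x' y' z' :
  (g \o h) (a' *: (x' - y') + z') = a' *: ((g \o h) x' - (g \o h) y') + (g \o h) z'.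
  by rewrite /= hE gE.
by rewrite -[X in (g \o h) (_ *: X + _)]subr0 ghE addrA.
Qed.

Lemma affine_shift (c : N) : affine_map (fun x => x + c).
Proof. by apply/affine_mapP => a x y; rewrite add0r !addrK. Qed.

Variables (T : Type) (f : N -> T).

(** Invariance under [g] gives it under the inverse [h]: [f (h x) = f (g (h x)) = f x]. *)
Lemma aff_stabI (g : N -> N) :
  affine_map g -> bijective g -> (forall x, f (g x) = f x) -> aff_stab f g.
Proof.
move=> ga gb fg; split; first by split.
case: gb => h gK hK; exists h; split=> //; apply/funext => x /=.
by rewrite -[in RHS](hK x) fg.
Qed.

Lemma aff_stab_inv (g : N -> N) : aff_stab f g ->
  exists h, [/\ aff_stab f h, cancel g h & cancel h g].
Proof.
move=> [[ga gb] [h [gK hK fh]]]; exists h; split=> //; apply: aff_stabI.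
- exact: affine_inv gK hK.
- by exists g.
- by move=> x; rewrite -[in RHS]fh.
Qed.

Lemma aff_stab_f (g : N -> N) x : aff_stab f g -> f (g x) = f x.
Proof. by move=> [_ [h [gK hK fh]]]; rewrite -[in LHS]fh /= gK. Qed.

Lemma aff_stab_comp (g h : N -> N) :
  aff_stab f g -> aff_stab f h -> aff_stab f (g \o h).
Proof.
move=> gs hs; apply: aff_stabI.
- by apply: affine_comp; [case: gs => -[]|case: hs => -[]].
- by apply: bij_comp; [case: gs => -[]|case: hs => -[]].
- by move=> x /=; rewrite !aff_stab_f.
Qed.

(** A map sending [x] to [x0] is followed by the inverse of one sending [y] to [x0]. *)
Lemma aff_stab_transitive (x0 : N) :
  (forall x, f x = f x0 -> exists2 g, aff_stab f g & g x = x0) ->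
  acts_transitively (aff_stab f) (f @^-1` [set f x0]).
Proof.
move=> to_x0; split; first by exists x0.
  by move=> g x gs /=; rewrite aff_stab_f.
move=> x y /= /to_x0[g gs gx] /to_x0[h hs hy].
have [k [ks hK kK]] := aff_stab_inv hs.
by exists (k \o g); [exact: aff_stab_comp|rewrite /= gx -hy hK].
Qed.

End LinearMaps.

(** * Direct decompositions and their component projections *)

Lemma fsum_ord (V : nmodType) (I : set nat) (u : nat -> V) M :
  (forall k, I k -> (M <= k)%N -> u k = 0) ->
  \sum_(k \in I) u k = \sum_(k < M | (k : nat) \in I) u k.
Proof.
move=> u0; rewrite (@fsbigE _ _ _ _ _ [seq i <- iota 0 M | i \in I]).
  rewrite big_filter_cond -[RHS](big_mkord _ u) /index_iota subn0.
  by apply: eq_bigl => i; rewrite andbb.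
- by rewrite filter_uniq // iota_uniq.
- by move=> i /=; rewrite mem_filter => /andP[/set_mem].
- move=> i Ii; rewrite mem_filter mem_set //= mem_iota add0n -leqNgt; exact: u0.
Qed.

Section Decomposition.
Variables (F : fieldType) (N : lmodType F) (G : nat -> set N).

Lemma component_bound (I : set nat) (u : nat -> N) : component_family G I u ->
  exists M, forall k, I k -> (M <= k)%N -> u k = 0.
Proof.
move=> [_ /finite_seqP[s sE]]; exists (\max_(i <- s) i).+1 => k Ik.
apply: contraTeq => uk0; rewrite -ltnNge ltnS.
have ks : k \in s by have : [set` s] k by rewrite -sE.
exact: leq_bigmax_seq.
Qed.

(** The index 0, which the decomposition ignores, is given the value 0, so that the family is unique
    on all of [nat]. *)
Definition expansion (x : N) (u : nat -> N) :=
  [/\ u 0%N = 0, forall k, (0 < k)%N -> G k (u k) &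
    exists M, (forall k, (M <= k)%N -> u k = 0) /\ x = \sum_(k < M) u k].

Lemma expansion_widen (u : nat -> N) M : (forall k, (M <= k)%N -> u k = 0) ->
  forall M', (M <= M')%N -> \sum_(k < M') u k = \sum_(k < M) u k.
Proof.
move=> uM M' MM'; rewrite -!(big_mkord predT u) (big_cat_nat (leq0n M) MM') /=.
rewrite [X in _ + X]big_nat [X in _ + X]big1 ?addr0 // => k /andP[Mk _]; exact: uM.
Qed.

Hypothesis Gdec : direct_decomposition G.

Lemma component0 k : (0 < k)%N -> G k 0.
Proof. by case: Gdec => Gsub _ _ /Gsub[]. Qed.

Lemma expansion_exists x : exists u, expansion x u.
Proof.
case: Gdec => _ Gsum _; have : [set: N] x by [].
rewrite -Gsum => -[u uG ->].
have [M uM] := component_bound uG.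
exists (fun k => if (0 < k)%N then u k else 0); split=> //.
  by move=> k k0; rewrite k0; apply: uG.1.
exists M; split; first by move=> k Mk; case: ifP => // k0; exact: uM.
rewrite (fsum_ord uM) big_mkcond; apply: eq_bigr => k _; congr (if _ then _ else _).
by apply/idP/idP => [/set_mem|k0] //; exact/mem_set.
Qed.

Lemma expansion_linear a x y u v : expansion x u -> expansion y v ->
  expansion (a *: x + y) (fun k => a *: u k + v k).
Proof.
move=> [u0 uG [M [uM ->]]] [v0 vG [M' [vM ->]]]; split.
- by rewrite u0 v0 scaler0 addr0.
- move=> k k0; case: Gdec => Gsub _ _; case: (Gsub k k0) => _ Glin.
  by apply: Glin; [exact: uG|exact: vG].
- exists (maxn M M'); split=> [k|].
    by rewrite geq_max => /andP[Mk Mk']; rewrite uM // vM // scaler0 addr0.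
  rewrite big_split /= -scaler_sumr (expansion_widen uM (leq_maxl M M')).
  by rewrite (expansion_widen vM (leq_maxr M M')).
Qed.

Lemma expansion0_uniq u : expansion 0 u -> forall k, u k = 0.
Proof.
move=> [u0 uG [M [uM]]] su [//|k]; case: Gdec => _ _ Guniq; apply: (Guniq u) => //.
  split=> //; apply: (@sub_finite_set _ _ `I_M); last exact: finite_II.
  move=> i [_]; apply: contraNT => /=; rewrite -leqNgt => /uM ->; exact: eqxx.
rewrite (@fsum_ord _ _ _ M); last by move=> i _; exact: uM.
(* The bounded sum has one extra index, 0, where [u] vanishes. *)
rewrite [RHS]su big_mkcond; apply: eq_bigr => i _; case: ifPn => // /negP.
rewrite mem_setE /= => /negP; rewrite -leqNgt leqn0 => /eqP ->; exact/esym.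
Qed.

(** Expansions are chosen pointwise; being unique and compatible with linear combinations, they
    depend linearly on the vector. *)
Lemma graded_projections : exists p : nat -> {linear N -> N},
  (forall x, expansion x (p^~ x)) /\
  (forall x u, expansion x u -> forall k, p k x = u k).
Proof.
have /choice[c cP] := expansion_exists.
have cU x u : expansion x u -> forall k, c x k = u k.
  move=> xu k; apply/eqP; rewrite -subr_eq0 addrC -scaleN1r; apply/eqP.
  have xx0 : -1 *: x + x = 0 by rewrite scaleN1r addNr.
  by have := expansion_linear (-1) xu (cP x); rewrite xx0 => /expansion0_uniq ->.
have /choice[p pE] : forall k, exists L : {linear N -> N}, (c^~ k) =1 L.
  move=> k; apply: linear_bundle => a x y.
  exact: (cU _ _ (expansion_linear a (cP x) (cP y)) k).
exists p; split=> [x|x u xu k]; last by rewrite -pE; exact: cU.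
by rewrite (_ : p^~ x = c x) //; apply/funext => k; rewrite -pE.
Qed.

End Decomposition.

(** * The exponential of a nilpotent algebra inside its unitization *)

Section NilpotentExponential.
Variables (F : fieldType) (N : lmodType F) (mul : {bilinear N -> N -> N}).
Variables (mulA : associative mul) (mulC : commutative mul).
Local Notation A := (unitization mulA mulC).

(* exp1 x is exp - 1 in the unitization, where the image of aug is the
   augmentation ideal. *)
Definition aug (x : N) : A := (0, x).

Fact aug_linear : linear aug.
Proof. by move=> a x y; congr pair; rewrite /= scaler0 addr0. Qed.
HB.instance Definition _ := GRing.isLinear.Build F N A _ aug aug_linear.

Lemma augM (x : N) (a : A) : aug x * a = aug (a.1 *: x + mul x a.2).
Proof. by congr pair; rewrite /= ?mul0r // scale0r add0r. Qed.

Lemma augMaug (x y : N) : aug x * aug y = aug (mul x y).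
Proof. by rewrite augM scale0r add0r. Qed.

Lemma augK (a : A) : a.1 = 0 -> a = aug a.2.
Proof. by case: a => a x /= ->. Qed.

Lemma aug_expr (x : N) k : aug x ^+ k.+1 = aug (elt_pow mul x k.+1).
Proof. by elim: k => // k IHk; rewrite exprS IHk augMaug. Qed.

(** Powers of the augmentation ideal; the power 0 is the whole unitization and is treated apart
    because [alg_pow] has a junk value at 0. *)
Fixpoint aug_power (k : nat) (a : A) : Prop :=
  if k is 0 then True else exists2 x, a = aug x & alg_pow mul k x.

Lemma aug_powerS (x : N) k a : aug_power k a -> aug_power k.+1 (aug x * a).
Proof.
case: k => [_|k [y -> ky]] /=.
  by rewrite augM; eexists; [reflexivity|].
rewrite augMaug; exists (mul x y) => //.
exists 1%N, (fun=> 1), (fun=> mul x y); split; last by rewrite big_ord1 scale1r.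
by move=> _; exists x => //; exists y.
Qed.

Lemma aug_power_expr (x y : N) i j : aug_power (i + j) (aug x ^+ i * aug y ^+ j).
Proof.
elim: i => [|i IHi]; last by rewrite exprS -mulrA; exact: aug_powerS.
rewrite mul1r; elim: j => // j IHj; rewrite exprS; exact: aug_powerS.
Qed.

Variable K0 : nat.
Local Notation K := K0.+1.
Hypothesis mul_nil : alg_pow mul K `<=` [set 0].

Lemma alg_pow_stable m : (K <= m)%N -> alg_pow mul m `<=` [set 0].
Proof.
move=> /subnK <-; elim: (m - K)%N => // n IHn x.
rewrite addSn addnS; case=> [k [a [v [vP ->]]]]; apply: big1 => i _.
have [y _ [z zP <-]] := vP i.
have -> : z = 0 by apply: IHn; rewrite addnS.
by rewrite linear0r scaler0.
Qed.

Lemma aug_nilp (x y : N) i j : (K <= i + j)%N -> aug x ^+ i * aug y ^+ j = 0.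
Proof.
move=> Kij; have := aug_power_expr x y i j; case: (i + j)%N Kij => // n Kn [z -> zP].
by rewrite (alg_pow_stable Kn zP) linear0.
Qed.

Lemma aug_nil (x : N) : aug x ^+ K = 0.
Proof. by rewrite -[LHS]mulr1 -(expr0 (aug x)) aug_nilp // addn0. Qed.

Hypothesis charF0 : [pchar F] =i pred0.

Lemma texp_aug (x : N) : texp K (aug x) = 1 + aug (exp1 mul x).
Proof.
(* Truncation at [K] loses no term of [exp1]. *)
have z k : (0 < k)%N -> (K <= k)%N -> elt_pow mul x k = 0.
  case: k => // k _ kK; have := aug_nilp x 0 (i := k.+1) (j := 0).
  by rewrite addn0 mulr1 aug_expr => /(_ kK) [].
rewrite /exp1 (@fsum_ord _ _ _ K); last by move=> k k0 kK; rewrite z // scaler0.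
rewrite big_mkcond big_ord_recl /= ifN; last first.
  by apply/negP => /set_mem.
rewrite add0r linear_sum /texp big_ord_recl expr0 fact0 invr1 scale1r.
congr (_ + _); apply: eq_bigr => i _; rewrite ifT; last exact/mem_set.
by rewrite linearZ /= -aug_expr.
Qed.

Lemma texp_augD (x y : N) : texp K (aug (x + y)) = texp K (aug x) * texp K (aug y).
Proof. by rewrite linearD /= texpD //; exact: aug_nilp. Qed.

(** * Weights in the unitization of a [pi]-graded algebra *)

Section Grading.
Variables (pi : {linear N -> N}) (G : nat -> set N) (d : nat).
Hypotheses (d_gt0 : (0 < d)%N) (G_grading : pi_grading mul pi G)
  (pi_n : forall k, (0 < k)%N -> k <> d -> pi @` G k `<=` [set 0]).
Variable p : nat -> {linear N -> N}.
Hypotheses (pP : forall x, expansion G x (p^~ x))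
  (pU : forall x u, expansion G x u -> forall k, p k x = u k).

Definition lam (a : A) : N := pi a.2.
Fact lam_linear : linear lam.
Proof. by move=> c a b; rewrite /lam /= linearP. Qed.
HB.instance Definition _ := GRing.isLinear.Build F A N _ lam lam_linear.

(** Factors are appended on the right, to match the [foldl] in [pi_grading]. *)
Inductive mono : nat -> A -> Prop :=
| mono1 : mono 0 1
| monoM k y m b : (0 < k)%N -> G k y -> mono m b -> mono (m + k) (b * aug y).

(** The grading puts the [pi]-image of a nonempty monomial into that of [G m], which is 0. The empty
    monomial is 1, whose component in [N] is 0. *)
Lemma lam_mono m b : mono m b -> m <> d -> lam b = 0.
Proof.
move=> mb md.
have : (b = 1 /\ m = 0%N) \/ exists j js y, [/\ all (fun i => 0 < i)%N (j :: js),
    m = sumn (j :: js), b = aug y &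
    foldl (fun A i => mulset mul A (G i)) (G j) js y].
  elim: mb {md} => [|k y {}m {}b k0 Gy _ [[-> ->]|[j [js [z [jP -> -> zP]]]]]].
    by left.
    right; exists k, [::], y; rewrite mul1r; split=> //=.
      by rewrite k0.
    by rewrite addn0.
  right; exists j, (rcons js k), (mul z y); split.
  - by rewrite /= all_rcons k0.
  - by rewrite /= sumn_rcons addnA.
  - exact: augMaug.
  - by rewrite -cats1 foldl_cat /=; exists z => //; exists y.
case=> [[-> _]|[j [js [y [jP mE -> yP]]]]]; first exact: linear0.
case: G_grading => _ _ Gpi.
have /(Gpi j js jP) :
  (pi @` foldl (fun A i => mulset mul A (G i)) (G j) js) (pi y) by exists y.
rewrite -mE => -[z zG piz]; rewrite /lam -piz.
apply: (pi_n _ md); last by exists z.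
by rewrite mE /= addn_gt0; case/andP: jP => ->.
Qed.

(* N_j N_k need not lie in N_(j+k): only the projections by pi behave as in a
   graded algebra.  Weights are therefore defined by duality, through the
   monomials on which pi vanishes, which makes them multiplicative. *)
Definition wtest n (a : A) := forall m b, mono m b -> (n + m)%N <> d -> lam (a * b) = 0.

Definition weight m (a : A) := forall n b, wtest n b -> wtest (m + n) (a * b).

Lemma wtest1 : wtest 0 1.
Proof. by move=> m b mb md; rewrite mul1r; exact: lam_mono mb _. Qed.

Lemma weight_lam m a : weight m a -> m <> d -> lam a = 0.
Proof.
move=> /(_ _ _ wtest1) /(_ _ _ mono1) W md.
by rewrite -[a]mulr1 -[a * 1]mulr1 W // !addn0.
Qed.

Lemma weight0 m : weight m 0.
Proof. by move=> n b _ k c _ _; rewrite !mul0r linear0. Qed.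

Lemma weight1 : weight 0 1.
Proof. by move=> n b; rewrite mul1r. Qed.

Lemma weightD m a b : weight m a -> weight m b -> weight m (a + b).
Proof.
move=> Wa Wb n c Wc k e ke kd; rewrite !mulrDl linearD /=.
by rewrite (Wa _ _ Wc _ _ ke kd) (Wb _ _ Wc _ _ ke kd) addr0.
Qed.

Lemma weightZ m (c : F) a : weight m a -> weight m (c *: a).
Proof.
move=> Wa n b Wb k e ke kd.
by rewrite -!scalerAl linearZ /= (Wa _ _ Wb _ _ ke kd) scaler0.
Qed.

Lemma weightM m n a b : weight m a -> weight n b -> weight (m + n) (a * b).
Proof. by move=> Wa Wb k c Wc; rewrite -mulrA -addnA; apply/Wa/Wb. Qed.

Lemma weightX m a i : weight m a -> weight (i * m) (a ^+ i).
Proof.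
move=> Wa; elim: i => [|i IHi]; first exact: weight1.
by rewrite exprS mulSn; exact: weightM.
Qed.

(** The factor [aug x] is moved into the test monomial, whose degree grows by [k]. *)
Lemma weight_aug k x : (0 < k)%N -> G k x -> weight k (aug x).
Proof.
move=> k0 Gx n b Wb m c mc md; rewrite [aug x * b]mulrC -mulrA [aug x * c]mulrC.
apply: (Wb (m + k)%N); first exact: monoM.
by rewrite [(m + k)%N]addnC addnA [(n + k)%N]addnC.
Qed.

(** * The function [f] and the filtration by lowest degree *)

Definition level (x : N) : N := pi (exp1 mul x).

Lemma levelE x : level x = lam (texp K (aug x)).
Proof. by rewrite texp_aug linearD /= /lam linear0 add0r. Qed.

Lemma level0 : level 0 = 0.
Proof.
rewrite levelE linear0 texp_expand ?expr0n // big1 ?addr0 ?/lam ?linear0 // => i _.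
by rewrite expr0n scaler0.
Qed.

Lemma projG k x : (0 < k)%N -> G k (p k x).
Proof. by case: (pP x) => _ + _; exact. Qed.

Lemma proj0 x : p 0%N x = 0.
Proof. by case: (pP x). Qed.

Lemma proj_sum x : exists M, x = \sum_(k < M) p k x.
Proof. by case: (pP x) => _ _ [M [_]]; exists M. Qed.

Lemma proj_component k x l : (0 < k)%N -> G k x -> p l x = if l == k then x else 0.
Proof.
case: G_grading => Gdec _ _ k0 Gx.
apply: (pU (u := fun l => if l == k then x else 0)); split.
- by rewrite eq_sym (gtn_eqF k0).
- by move=> i i0; case: eqVneq => [->|_] //; exact: component0.
- exists k.+1; split; first by move=> i ki; rewrite gtn_eqF.
  rewrite big_ord_recr /= eqxx big1 ?add0r // => i _.
  by rewrite ltn_eqF.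
Qed.

(** Membership in the sum of the components of degree at least [k]. *)
Definition filtered k (x : N) := forall l, (l < k)%N -> p l x = 0.

Lemma filteredD k x y : filtered k x -> filtered k y -> filtered k (x + y).
Proof. by move=> xk yk l lk; rewrite linearD /= xk // yk // addr0. Qed.

Lemma filtered_sum k n (h : 'I_n -> N) :
  (forall i, filtered k (h i)) -> filtered k (\sum_(i < n) h i).
Proof. by move=> hk l lk; rewrite linear_sum big1 // => i _; exact: hk. Qed.

Lemma filteredW k k' x : (k' <= k)%N -> filtered k x -> filtered k' x.
Proof. by move=> kk' xk l lk'; apply: xk; exact: leq_trans kk'. Qed.

Lemma filtered_mulG k x y : (0 < k)%N -> G k x -> filtered k.+1 (mul x y).
Proof.
case: G_grading => _ Gmul _ k0 Gx.
have /(Gmul k k0)[u uG ->] : mulset mul (G k) [set: N] (mul x y).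
  by exists x => //; exists y.
have [M uM] := component_bound uG.
rewrite (fsum_ord uM) => l lk; rewrite linear_sum big1 // => i /set_mem /= ki.
by rewrite (@proj_component i) ?ltn_eqF //;
  [exact: leq_trans lk _|exact: leq_ltn_trans ki|exact: uG.1].
Qed.

(** Components of [z] have degree at least [d] and those of [y] positive degree, so every product of
    components has weight above [d]. *)
Lemma lam_filtered z y : filtered d z -> lam (aug z * aug y) = 0.
Proof.
move=> zd; have [M zE] := proj_sum z; have [M' yE] := proj_sum y.
rewrite [in aug z]zE [in aug y]yE !(linear_sum aug) mulr_suml linear_sum big1 // => i _.
have [id|di] := ltnP i d; first by rewrite zd // linear0 mul0r linear0.
rewrite mulr_sumr linear_sum big1 // => l _.
case: (posnP l) => [->|l0]; first by rewrite proj0 linear0 mulr0 linear0.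
apply: (@weight_lam (i + l)); last first.
  by apply/eqP; rewrite gtn_eqF // (leq_ltn_trans di) // -addn1 leq_add2l.
have i0 := leq_trans d_gt0 di.
by apply: weightM; apply: weight_aug => //; exact: projG.
Qed.

Lemma pi_filtered z : filtered d.+1 z -> pi z = 0.
Proof.
move=> zd; have [M zE] := proj_sum z.
rewrite [in pi z]zE linear_sum big1 // => i _.
case: (posnP i) => [->|i0]; first by rewrite proj0 linear0.
have [->|/eqP id] := eqVneq (i : nat) d; first by rewrite zd // linear0.
by apply: (pi_n i0 id); exists (p i z) => //; exact: projG.
Qed.

(** As [exp z = 1 + z + z^2 e], the product [exp y exp z] is [exp y + z + z w] with [w] in the
    augmentation ideal, and [lam_filtered] kills [z w]. *)
Lemma level_shift y z : filtered d z -> level (y + z) = level y + pi z.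
Proof.
move=> zd; rewrite !levelE texp_augD.
have [e eE] := texp_order2 (aug_nil z).
pose w := aug (exp1 mul y) + aug z * (e + aug (exp1 mul y) * e).
have wE : w = aug w.2 by apply: augK; rewrite /w augM /= addr0.
have -> : texp K (aug y) * texp K (aug z) = texp K (aug y) + (aug z + aug z * w).
  by rewrite eE texp_aug /w; ring.
by rewrite !linearD /= wE lam_filtered // addr0.
Qed.

(** * Affine maps preserving [f], and their orbits *)

Lemma texp_log_aug (j : nat) s : exists t,
  texp K (aug ((j%:R - d%:R) *: s + mul s t)) =
  texp K (- (aug s *+ d)) * (1 + aug s *+ j).
Proof.
have [|c cE] := @texp_log _ charF0 _ K (aug s *+ j).
  by rewrite -scaler_nat exprZn aug_nil scaler0.
(* With [log (1 + j s) = j s + (j s)^2 c], the exponent is [(j - d) s + s e], so [t] is the [N]-part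
   of [e = j^2 s c]. *)
pose e := aug s * (c *+ j *+ j); have eE : e = aug e.2 by rewrite /e augM.
exists e.2; rewrite -cE.
have -> : - (aug s *+ d) = aug s * (- d%:R) by ring.
have -> : aug s *+ j + (aug s *+ j) ^+ 2 * c = aug s * (j%:R + e) by rewrite /e; ring.
rewrite -texpD_dvd ?aug_nil //; congr (texp K _).
rewrite linearD linearZ /= -augMaug -eE scalerBl !scaler_nat; ring.
Qed.

Lemma expr_aug1 (a : A) k : a.1 = 1 -> (a ^+ k).1 = 1.
Proof. by move=> a1; elim: k => // k IHk; rewrite exprS /= a1 IHk mulr1. Qed.

(** Here [D x] is the sum of the [x_k (exp(k s) - 1)] for [k <= d]. It raises the filtration because
    a product with [x_k] lies in degrees above [k]. *)
Lemma reparam_aff_stab j s : (0 < j)%N -> G j s ->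
  exists (D : {linear N -> N}) (t : N),
    aff_stab level (fun x => x + D x + ((j%:R - d%:R) *: s + mul s t)) /\
    forall k x, filtered k x -> filtered k.+1 (D x).
Proof.
move=> j0 Gs; have [t tE] := texp_log_aug j s; set b := _ *: s + _ in tE *.
pose u := texp K (aug s); pose v k := (u ^+ k).2.
have u1 : u.1 = 1 by rewrite /u texp_aug /= addr0.
have augu x k : aug x * u ^+ k = aug (x + mul x (v k)).
  by rewrite augM expr_aug1 // scale1r.
have [|D DE] := @linear_bundle _ _ (fun x => \sum_(k < d) mul (p k.+1 x) (v k.+1)).
  move=> c x y; rewrite scaler_sumr -big_split; apply: eq_bigr => k _ /=.
  by rewrite linearP linearPl.
have DF k x : filtered k x -> filtered k.+1 (D x).
  move=> xk; rewrite -DE; apply: filtered_sum => i.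
  have [ik|ki] := ltnP i.+1 k.
    by rewrite xk // linear0l => l _; rewrite linear0.
  apply: (@filteredW i.+2) => //; apply: filtered_mulG => //; exact: projG.
exists D, t; split=> //; apply: aff_stabI.
- have [|L LE] := @linear_bundle _ _ (fun x => x + D x).
    by move=> c x y; rewrite linearP scalerDr addrACA.
  by exists L, b => x; rewrite LE.
(* After [d.+1] applications no component of degree at most [d] remains, and [D] depends on these
   alone. *)
- have D0 x : iter d.+2 D x = 0.
    have xd : filtered d.+1 (iter d.+1 D x).
      by elim: d.+1 => [|k IHk]; [move=> l|exact: DF].
    rewrite iterS -DE; apply: big1 => k _.
    by rewrite xd ?linear0l // ltnS.
  apply: (bij_comp (f := fun x => x + b) (h := fun x => x + D x)).
    by exists (fun x => x - b) => x; rewrite ?addrK ?subrK.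
  exact: unipotent_bijective D0.
- move=> x; pose y := \sum_(k < d) p k.+1 x.
  have yd : filtered d.+1 (x - y).
    move=> l ld; rewrite linearB linear_sum /=; apply/eqP; rewrite subr_eq0; apply/eqP.
    case: l ld => [|l] ld; first by rewrite proj0 big1 // => i _; rewrite proj0.
    rewrite (bigD1 (@Ordinal d l ld)) //= (@proj_component l.+1 (p l.+1 x)) ?eqxx //;
      last exact: projG.
    rewrite big1 ?addr0 // => i il; rewrite (@proj_component i.+1 (p i.+1 x)) //;
      last exact: projG.
    by case: eqVneq => // -[li]; case/eqP: il; apply/val_inj.
  have yd' : filtered d (x - y) by exact: filteredW yd.
  rewrite -[in RHS](subrK y x) [in RHS]addrC [RHS]level_shift // pi_filtered // addr0.
  have -> : x + D x + b = (y + D x + b) + (x - y).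
    by rewrite [RHS]addrC -!addrA addKr.
  rewrite level_shift // pi_filtered // addr0 !levelE.
  (* The indeterminate records degrees: [X] takes the value [y] at 1 and [y + D x] at
     [u = exp s]. *)
  pose X : {poly A} := \sum_(k < d) aug (p k.+1 x) *: 'X^(k.+1).
  have Xh a : X.[a] = \sum_(k < d) aug (p k.+1 x) * a ^+ k.+1.
    by rewrite horner_sum; apply: eq_bigr => k _; rewrite hornerZ hornerXn.
  have X1 : X.[1] = aug y.
    by rewrite Xh linear_sum; apply: eq_bigr => k _; rewrite expr1n mulr1.
  have Xu : X.[u] = aug (y + D x).
    rewrite Xh -DE -big_split linear_sum; apply: eq_bigr => k _; exact: augu.
  rewrite addrC texp_augD -Xu -X1 tE -!(horner_texp K) -tE.
  (* Coefficient [m] of the exponential of [X] has weight [m], and [aug s ^+ i.+1] has weight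
     [i.+1 * j]. *)
  apply: (texp_reparam charF0 (aug_nil s) tE) => m i mi.
  apply: weight_lam mi; apply: weightM; last by apply: weightX; exact: weight_aug.
  move: m; apply: (weight_texp K weight0 weight1 weightD weightZ weightM) => m.
  rewrite coef_sum; apply: (weight_sum weight0 weightD) => k _.
  rewrite coefZ coefXn; case: eqVneq => [->|_]; last by rewrite mulr0; exact: weight0.
  by rewrite mulr1; apply: weight_aug => //; exact: projG.
Qed.

(** Each step clears the lowest degree [j = d - n] while [n > 0]. For [n = 0], [level a] is [pi a],
    so translation by [- a] preserves [level]. *)
Lemma move_to_zero n a : (n < d)%N -> filtered (d - n) a -> level a = 0 ->
  exists2 g, aff_stab level g & g a = 0.
Proof.
elim: n a => [|n IHn] a nd; rewrite ?subn0 => ad fa.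
  have pia : pi a = 0 by move: (level_shift 0 ad); rewrite add0r fa level0 add0r.
  exists (fun x => x - a); last exact: subrr.
  apply: aff_stabI; first exact: affine_shift.
    by exists (fun x => x + a) => x; rewrite ?subrK ?addrK.
  by move=> x; rewrite -[in RHS](subrK a x) [RHS]level_shift // pia addr0.
set j := (d - n.+1)%N in ad.
have j0 : (0 < j)%N by rewrite subn_gt0.
have jd : (d - j)%N = n.+1 by rewrite subKn // ltnW.
have jS : (d - n)%N = j.+1 by rewrite /j subnSK // ltnW.
have jd_n : j%:R - d%:R = - n.+1%:R :> F.
  have jd_le : (j <= d)%N := leq_subr _ _.
  by rewrite -jd (natrB _ jd_le) opprB.
(* The translation part of the map starts with [(j - d) s = - n.+1 s]; this [s] makes it cancel
   [p j a]. *)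
have Gpa := projG a j0; pose s := n.+1%:R^-1 *: p j a.
have Gs : G j s.
  case: G_grading => -[Gsub _ _] _ _; case: (Gsub j j0) => G0 Glin.
  by rewrite -[s]addr0; exact: Glin.
have [D [t [gs DF]]] := reparam_aff_stab j0 Gs.
set g := (fun x => _) in gs.
have ga : filtered j.+1 (g a).
  rewrite /g jd_n scaleNr /s scalerA mulfV; last first.
    by rewrite ((pcharf0P F).1 charF0).
  (* Regrouped, [g a] is the sum of [a - p j a], [D a] and [mul s t], all in degrees above [j]. *)
  rewrite scale1r addrACA; apply: filteredD; last apply: filteredD.
  - move=> l; rewrite ltnS leq_eqVlt linearB /= (@proj_component j (p j a)) //.
    case/orP=> [/eqP->|lj].
      by rewrite eqxx subrr.
    by rewrite ltn_eqF // subr0 ad.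
  - exact: DF.
  - exact: filtered_mulG.
rewrite -jS in ga.
have [||h hs hg] := IHn (g a) _ ga; first exact: ltnW.
  by rewrite (aff_stab_f a gs).
by exists (h \o g) => //; exact: aff_stab_comp.
Qed.

Lemma level_zero_orbit a : level a = 0 -> exists2 g, aff_stab level g & g a = 0.
Proof.
apply: (@move_to_zero d.-1); first by rewrite prednK.
by rewrite -{1}(prednK d_gt0) subSnn => -[|//] _; rewrite proj0.
Qed.

(** Translation by [c] changes [level] by the constant [pi c], so conjugation by it preserves the
    stabilizer. *)
Lemma aff_stab_conj c g : filtered d c -> aff_stab level g ->
  aff_stab level (fun x => g (x - c) + c).
Proof.
move=> cd gs; have [[ga [h gK hK]] _] := gs; apply: aff_stabI.
- exact: (affine_comp (affine_shift c) (affine_comp ga (affine_shift (- c)))).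
- by exists (fun x => h (x - c) + c) => x; rewrite addrK ?gK ?hK subrK.
- by move=> x; rewrite level_shift // (aff_stab_f _ gs) -level_shift // subrK.
Qed.
End Grading.
End NilpotentExponential.

Theorem mainTheorem2 (F : fieldType) (charF0 : [pchar F] =i pred0)
    (N : lmodType F) (mul : {bilinear N -> N -> N})
    (mulA : associative mul) (mulC : commutative mul)
    (mul_nil : nilpotent_alg mul)
    (pi : {linear N -> N}) (pi_proj : pi \o pi = pi :> (N -> N))
    (G : nat -> set N) (G_grading : pi_grading mul pi G)
    (d : nat) (d_gt0 : (0 < d)%N)
    (pi_d : range pi `<=` G d)
    (pi_n : forall k, (0 < k)%N -> k <> d -> pi @` G k `<=` [set 0]) :
  let f : N -> N := pi \o exp1 mul in
  let S : set N := f @^-1` [set 0] in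
  acts_transitively (aff_stab f) S /\
  (range pi `<=` annihilator mul ->
   forall c, range pi c ->
     f @^-1` [set c] = [set s + c | s in S] /\
     acts_transitively (aff_stab f) (f @^-1` [set c])).
Proof.
move=> f S; have [K mul_nilK] := mul_nil.
have [Gdec _ _] := G_grading; have [p [pP pU]] := graded_projections Gdec.
have lev0 : f 0 = 0 := level0 mulA mulC mul_nilK pi.
have orbit0 := level_zero_orbit mulA mulC mul_nilK charF0 d_gt0 G_grading pi_n pP pU.
split.
  by rewrite /S -lev0; apply: aff_stab_transitive => x; rewrite lev0; exact: orbit0.
move=> _ c pic.
have cd : filtered p d c.
  move=> l ld; rewrite (proj_component G_grading pU l d_gt0 (pi_d _ pic)).
  by rewrite ltn_eqF.
(* [c] has degree [d], and the idempotent [pi] fixes it. *)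
have fD x : f (x + c) = f x + c.
  rewrite [LHS](level_shift mulA mulC mul_nilK charF0 d_gt0 G_grading pi_n pP x cd).
  by congr (_ + _); case: pic => y _ <-; rewrite -[LHS]/((pi \o pi) y) pi_proj.
have fc : f c = c by rewrite -[c in f c]add0r fD lev0 add0r.
split.
  apply/seteqP; split=> x /=.
    move=> fx; exists (x - c); last exact: subrK.
    by rewrite /S /=; apply: (addIr c); rewrite -fD subrK add0r.
  by case=> s sS <-; rewrite fD [f s]sS add0r.
(* The base point is now [c], with [f c = c]; a map taking [x - c] to 0 is conjugated by the
   translation by [c]. *)
rewrite -[X in [set X]]fc; apply: aff_stab_transitive => x fx.
have fxc : f (x - c) = 0 by apply: (addIr c); rewrite -fD subrK fx fc add0r.
have [g gs gx] := orbit0 _ fxc.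
exists (fun y => g (y - c) + c); last by rewrite gx add0r.
exact: (aff_stab_conj mulA mulC mul_nilK charF0 d_gt0 G_grading pi_n pP cd gs).
Qed.
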